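(* Let $(\gamma,\nu):I\to\mathbb{R}^2\times S^1$ be a Legendre curve with curvature $(\ell,\beta)$, and write $\nu=(a,b)$. (1) Let $\Phi:\mathbb{R}^2\to\mathbb{R}^2$, $\Phi(x,y)=(a_{11}x+a_{12}y,\,a_{21}x+a_{22}y)$ with $a_{11},a_{12},a_{21},a_{22}\in\mathbb{R}$ and $a_{11}a_{22}-a_{12}a_{21}\neq0$. Then $t_0\in I$ is a singular point and a vertex of $\gamma$ if and only if $t_0$ is a singular point and a vertex of $\widetilde\gamma=\Phi\circ\gamma$, where $\widetilde\gamma$ is regarded as the frontal of the Legendre curve $(\widetilde\gamma,\widetilde\nu)$ with $\widetilde\nu=\overline\nu/|\overline\nu|$, $\overline\nu=(a_{22}a-a_{21}b,\,-a_{12}a+a_{11}b)$. (2) Let $\Phi:\mathbb{R}^2\to\mathbb{R}^2$, $\Phi(x,y)=(y,x)$. Then $t_0\in I$ is a vertex of $\gamma$ if and only if $t_0$ is a vertex of $\widetilde\gamma=\Phi\circ\gamma$, where $\widetilde\gamma$ is regarded as the frontal of the Legendre curve $(\widetilde\gamma,\widetilde\nu)$ with $\widetilde\nu=(-b,-a)$.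
   Context: All maps are $C^\infty$; $I$ is a closed interval. $\mathbb{R}^2$ has the standard inner product, $S^1\subset\mathbb{R}^2$ is the unit circle, and $J(x,y)=(-y,x)$. A smooth map $(\gamma,\nu):I\to\mathbb{R}^2\times S^1$ is a Legendre curve if $\dot\gamma(t)\cdot\nu(t)=0$ for all $t\in I$; then $\gamma$ is called a frontal. Put $\mu=J(\nu)$. The curvature $(\ell,\beta)$ is $\ell=\dot\nu\cdot\mu$, $\beta=\dot\gamma\cdot\mu$, so that $\dot\nu=\ell\mu$, $\dot\mu=-\ell\nu$, $\dot\gamma=\beta\mu$. A singular point of $\gamma$ is a point $t_0$ with $\dot\gamma(t_0)=0$, i.e. $\beta(t_0)=0$. The evolute of the frontal exists if there is a unique smooth $\alpha:I\to\mathbb{R}$ with $\beta=\alpha\ell$; it is then $\mathcal{E}v(\gamma)=\gamma-\alpha\nu$. A point $t_0\in I$ is a vertex of $\gamma$ (or of $(\gamma,\nu)$) if the evolute exists and $\frac{d}{dt}\mathcal{E}v(\gamma)(t_0)=0$, equivalently $\dot\alpha(t_0)=0$. *)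

(* Defs.v *)
From Stdlib Require Import Reals Lra ClassicalEpsilon.
Open Scope R_scope.

Definition R2 : Type := (R * R)%type.

Definition dot (v w : R2) : R := fst v * fst w + snd v * snd w.
Definition vnorm (v : R2) : R := sqrt (dot v v).
Definition vscale (c : R) (v : R2) : R2 := (c * fst v, c * snd v).
Definition vsub (v w : R2) : R2 := (fst v - fst w, snd v - snd w).
Definition J (v : R2) : R2 := (- snd v, fst v).

(* Bounded or not; single points are excluded so that derivatives make sense. *)
Definition closed_interval (D : R -> Prop) : Prop :=
  closed_set D /\
  (forall x y z, D x -> D y -> x <= z <= y -> D z) /\
  (exists x y, D x /\ D y /\ x < y).

(* A map on D is represented by a total function on R whose values off D are
   irrelevant: [D_in] takes difference quotients inside D only, so derivatives
   at endpoints of D are one-sided. *)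
Definition has_deriv (D : R -> Prop) (f : R -> R) (t l : R) : Prop :=
  D_in f (fun _ => l) D t.

(* Meaningful only where [has_deriv] holds for some l; arbitrary elsewhere. *)
Definition deriv (D : R -> Prop) (f : R -> R) (t : R) : R :=
  epsilon (inhabits 0) (has_deriv D f t).

Definition smooth (D : R -> Prop) (f : R -> R) : Prop :=
  forall (n : nat) (t : R), D t ->
    exists l, has_deriv D (Nat.iter n (deriv D) f) t l.

Definition vderiv (D : R -> Prop) (c : R -> R2) (t : R) : R2 :=
  (deriv D (fun s => fst (c s)) t, deriv D (fun s => snd (c s)) t).

Definition vsmooth (D : R -> Prop) (c : R -> R2) : Prop :=
  smooth D (fun s => fst (c s)) /\ smooth D (fun s => snd (c s)).

Definition legendre (D : R -> Prop) (gamma nu : R -> R2) : Prop :=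
  vsmooth D gamma /\ vsmooth D nu /\
  (forall t, D t -> vnorm (nu t) = 1) /\
  (forall t, D t -> dot (vderiv D gamma t) (nu t) = 0).

Definition curv_ell (D : R -> Prop) (nu : R -> R2) (t : R) : R :=
  dot (vderiv D nu t) (J (nu t)).

Definition curv_beta (D : R -> Prop) (gamma nu : R -> R2) (t : R) : R :=
  dot (vderiv D gamma t) (J (nu t)).

Definition singular_point (D : R -> Prop) (gamma : R -> R2) (t0 : R) : Prop :=
  D t0 /\ vderiv D gamma t0 = (0, 0).

Definition evolute_coef (D : R -> Prop) (gamma nu : R -> R2) (alpha : R -> R)
    : Prop :=
  smooth D alpha /\
  forall t, D t -> curv_beta D gamma nu t = alpha t * curv_ell D nu t.

(* alpha is the unique (as a function on D) smooth solution of
   beta = alpha * ell; the evolute exists when there is such an alpha. *)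
Definition unique_evolute_coef (D : R -> Prop) (gamma nu : R -> R2)
    (alpha : R -> R) : Prop :=
  evolute_coef D gamma nu alpha /\
  forall alpha', evolute_coef D gamma nu alpha' ->
    forall t, D t -> alpha' t = alpha t.

Definition evolute (gamma nu : R -> R2) (alpha : R -> R) (t : R) : R2 :=
  vsub (gamma t) (vscale (alpha t) (nu t)).

Definition vertex (D : R -> Prop) (gamma nu : R -> R2) (t0 : R) : Prop :=
  D t0 /\
  exists alpha, unique_evolute_coef D gamma nu alpha /\
    vderiv D (evolute gamma nu alpha) t0 = (0, 0).

(* Main.v *)
(** Put [mu = J nu], let [B] be the cofactor matrix of the matrix [A] of [Phi],
    [delta = det A], and let [c = 1 / |B nu|].  Since [A J = J B], the curvature
    of the image curve is [beta~ = beta / c], [ell~ = delta c^2 ell].  Hence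
    [alpha |-> alpha / (delta c^3)] is a bijection between the smooth solutions
    of [beta = alpha ell] and those of [beta~ = alpha~ ell~], so that one
    evolute exists iff the other does.  The derivative of [1 / (delta c^3)] is a
    multiple [ell s] of [ell], so [alpha~' = alpha' / (delta c^3) + alpha ell s]
    and [alpha ell s = beta s].  This last term vanishes at a singular point,
    and it vanishes identically when [A] is an isometry, because then [s = 0]. *)

Require Import Defs.
From Stdlib Require Import Reals Lra ClassicalEpsilon FunctionalExtensionality.
Open Scope R_scope.

(** * Calculus of derivatives relative to a subset of the line *)

Lemma has_deriv_ext (D : R -> Prop) (f g : R -> R) (t l : R) :
  D t -> (forall s, D s -> f s = g s) -> has_deriv D f t l -> has_deriv D g t l.
Proof.
  intros Dt E H eps He. destruct (H eps He) as [d [Hd Hl]].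
  exists d; split; [exact Hd|]. intros x [Hx Hxd].
  rewrite <- (E t Dt), <- (E x (proj1 Hx)). exact (Hl x (conj Hx Hxd)).
Qed.

Lemma has_deriv_val (D : R -> Prop) (f : R -> R) (t l l' : R) :
  l = l' -> has_deriv D f t l -> has_deriv D f t l'.
Proof. now intros ->. Qed.

Lemma has_deriv_const (D : R -> Prop) (k t : R) : has_deriv D (fun _ => k) t 0.
Proof. exact (Dconst D k t). Qed.

Lemma has_deriv_plus (D : R -> Prop) (f g : R -> R) (t l m : R) :
  has_deriv D f t l -> has_deriv D g t m ->
  has_deriv D (fun s => f s + g s) t (l + m).
Proof. exact (Dadd D (fun _ => l) (fun _ => m) f g t). Qed.

Lemma has_deriv_minus (D : R -> Prop) (f g : R -> R) (t l m : R) :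
  has_deriv D f t l -> has_deriv D g t m ->
  has_deriv D (fun s => f s - g s) t (l - m).
Proof. exact (Dminus D (fun _ => l) (fun _ => m) f g t). Qed.

Lemma has_deriv_mult (D : R -> Prop) (f g : R -> R) (t l m : R) :
  has_deriv D f t l -> has_deriv D g t m ->
  has_deriv D (fun s => f s * g s) t (l * g t + f t * m).
Proof. exact (Dmult D (fun _ => l) (fun _ => m) f g t). Qed.

Lemma has_deriv_scal (D : R -> Prop) (k : R) (f : R -> R) (t l : R) :
  has_deriv D f t l -> has_deriv D (fun s => k * f s) t (k * l).
Proof. exact (Dmult_const D f (fun _ => l) t k). Qed.

Lemma has_deriv_comp (D : R -> Prop) (f g : R -> R) (t l m : R) :
  has_deriv D f t l -> derivable_pt_lim g (f t) m ->
  has_deriv D (fun s => g (f s)) t (l * m).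
Proof.
  intros Hf Hg.
  apply (derivable_pt_lim_D_in g (fun _ => m)) in Hg.
  (* With the whole line as domain of [g], the domain of the composite reduces to [D]. *)
  pose proof (Dcomp D no_cond (fun _ => l) (fun _ => m) f g t Hf Hg) as H.
  intros eps He. destruct (H eps He) as [d [Hd Hl]].
  exists d; split; [exact Hd|]. intros x [[Dx Hx] Hxd]. apply Hl.
  repeat split; auto.
Qed.

Lemma has_deriv_inv (D : R -> Prop) (f : R -> R) (t l : R) :
  f t <> 0 -> has_deriv D f t l ->
  has_deriv D (fun s => / f s) t (- (l * (/ f t * / f t))).
Proof.
  intros Hf H.
  pose proof (derivable_pt_lim_div _ _ _ _ _ (derivable_pt_lim_const 1 (f t))
    (derivable_pt_lim_id (f t)) Hf) as E.
  replace (fun s => / f s) with (fun s => 1 / f s)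
    by (apply functional_extensionality; intros s; apply Rmult_1_l).
  refine (has_deriv_val D _ t _ _ _ (has_deriv_comp D _ _ t _ _ H E)).
  unfold id, fct_cte, Rsqr. field. exact Hf.
Qed.

Lemma has_deriv_sqrt (D : R -> Prop) (f : R -> R) (t l : R) :
  0 < f t -> has_deriv D f t l ->
  has_deriv D (fun s => sqrt (f s)) t (l * / (2 * sqrt (f t))).
Proof.
  intros Hf H. apply has_deriv_comp; [exact H|].
  now apply derivable_pt_lim_sqrt.
Qed.

(** Since [D] is convex with two distinct points, it contains points arbitrarily close to [t] on at
    least one side. This makes limits along [D] unique, also at endpoints. *)
Lemma interval_adherent (D : R -> Prop) (t : R) :
  closed_interval D -> D t -> adhDa (D_x D t) t.
Proof.
  intros [_ [conv [x [y [Dx [Dy xy]]]]]] Dt a Ha.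
  destruct (Rlt_or_le t y) as [ty|yt].
  - exists (Rmin y (t + a / 2)).
    assert (Hm : t < Rmin y (t + a / 2)) by (apply Rmin_glb_lt; lra).
    pose proof (Rmin_l y (t + a / 2)). pose proof (Rmin_r y (t + a / 2)).
    repeat split.
    + apply (conv t y _); auto; lra.
    + lra.
    + unfold Rdist. rewrite Rabs_right; lra.
  - exists (Rmax x (t - a / 2)).
    assert (Hm : Rmax x (t - a / 2) < t) by (apply Rmax_lub_lt; lra).
    pose proof (Rmax_l x (t - a / 2)). pose proof (Rmax_r x (t - a / 2)).
    repeat split.
    + apply (conv x t _); auto; lra.
    + lra.
    + unfold Rdist. rewrite Rabs_left; lra.
Qed.

(** * Smooth functions on a closed interval *)

Section Interval.

Context {D : R -> Prop} (hD : closed_interval D).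

Lemma has_deriv_unique (f : R -> R) (t l m : R) :
  D t -> has_deriv D f t l -> has_deriv D f t m -> l = m.
Proof.
  intros Dt Hl Hm.
  exact (single_limit _ _ l m t (interval_adherent D t hD Dt) Hl Hm).
Qed.

(** Uniqueness of the limit pins down the value chosen by [epsilon]. *)
Lemma has_deriv_deriv (f : R -> R) (t l : R) :
  D t -> has_deriv D f t l -> deriv D f t = l.
Proof.
  intros Dt H. apply (has_deriv_unique f t); auto.
  unfold deriv. apply epsilon_spec. now exists l.
Qed.

Lemma smooth_has_deriv (f : R -> R) (t : R) :
  smooth D f -> D t -> has_deriv D f t (deriv D f t).
Proof. intros H Dt. unfold deriv. apply epsilon_spec. exact (H 0%nat t Dt). Qed.

Lemma smooth_deriv (f : R -> R) : smooth D f -> smooth D (deriv D f).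
Proof.
  intros H n t Dt. destruct (H (S n) t Dt) as [l Hl]. exists l.
  now rewrite Nat.iter_succ_r in Hl.
Qed.

(* Smoothness by coinduction: a class of functions whose derivatives stay in the
   class consists of smooth functions, without computing iterated [deriv]s. *)
Lemma smooth_closed_class (S : (R -> R) -> Prop) :
  (forall f, S f -> exists g, S g /\ forall t, D t -> has_deriv D f t (g t)) ->
  forall f, S f -> smooth D f.
Proof.
  intros HS f Sf n.
  (* The iterated [deriv] is arbitrary off [D], so it is only compared on [D] with a member of the
     class. *)
  assert (E : exists g, S g /\
    forall t, D t -> g t = Nat.iter n (deriv D) f t).
  { induction n as [|n [g [Sg Eg]]]; [now exists f|].
    destruct (HS g Sg) as [h [Sh Hh]]. exists h; split; [exact Sh|].
    intros t Dt. simpl. symmetry. apply has_deriv_deriv; [exact Dt|].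
    apply (has_deriv_ext D g); auto. }
  destruct E as [g [Sg Eg]]. intros t Dt.
  destruct (HS g Sg) as [h [_ Hh]]. exists (h t).
  apply (has_deriv_ext D g); auto.
Qed.

(** The class fed to the coinduction: a product or quotient rule produces new sums and products, so
    the class is closed under all operations at once. *)
Inductive smooth_expr : (R -> R) -> Prop :=
| expr_smooth f : smooth D f -> smooth_expr f
| expr_const k : smooth_expr (fun _ => k)
| expr_plus f g :
    smooth_expr f -> smooth_expr g -> smooth_expr (fun s => f s + g s)
| expr_mult f g :
    smooth_expr f -> smooth_expr g -> smooth_expr (fun s => f s * g s)
| expr_inv f : smooth_expr f -> (forall t, D t -> f t <> 0) ->
    smooth_expr (fun s => / f s)
| expr_sqrt f : smooth_expr f -> (forall t, D t -> 0 < f t) ->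
    smooth_expr (fun s => sqrt (f s)).

Lemma smooth_expr_deriv (f : R -> R) : smooth_expr f ->
  exists g, smooth_expr g /\ forall t, D t -> has_deriv D f t (g t).
Proof.
  induction 1 as [f Hf|k|f g Sf [f' [Sf' Hf]] Sg [g' [Sg' Hg]]
    |f g Sf [f' [Sf' Hf]] Sg [g' [Sg' Hg]]
    |f Sf [f' [Sf' Hf]] N|f Sf [f' [Sf' Hf]] P].
  - exists (deriv D f). split.
    + now apply expr_smooth, smooth_deriv.
    + intros t Dt. now apply smooth_has_deriv.
  - exists (fun _ => 0). split; [apply expr_const|].
    intros t _. apply has_deriv_const.
  - exists (fun s => f' s + g' s). split; [now apply expr_plus|].
    intros t Dt. apply has_deriv_plus; auto.
  - exists (fun s => f' s * g s + f s * g' s). split.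
    + apply expr_plus; now apply expr_mult.
    + intros t Dt. apply has_deriv_mult; auto.
  (* The sign of the derivative of [/ f] becomes a constant factor, because negation is not among
     the constructors. *)
  - exists (fun s => (-1) * (f' s * (/ f s * / f s))). split.
    + repeat (apply expr_mult || apply expr_inv || apply expr_const); auto.
    + intros t Dt.
      apply (has_deriv_val D _ t (- (f' t * (/ f t * / f t)))); [ring|].
      apply has_deriv_inv; auto.
  - exists (fun s => f' s * / (2 * sqrt (f s))). split.
    + apply expr_mult; [exact Sf'|]. apply expr_inv.
      * apply expr_mult; [apply expr_const|now apply expr_sqrt].
      * intros t Dt. pose proof (sqrt_lt_R0 _ (P t Dt)). lra.
    + intros t Dt. apply has_deriv_sqrt; auto.
Qed.

Lemma smooth_of_expr (f : R -> R) : smooth_expr f -> smooth D f.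
Proof. apply smooth_closed_class. exact smooth_expr_deriv. Qed.

(** The functions that agree on [D] with some smooth function form a class closed under
    derivation. *)
Lemma smooth_ext (f g : R -> R) :
  (forall t, D t -> f t = g t) -> smooth D f -> smooth D g.
Proof.
  intros E Hf.
  apply (smooth_closed_class
    (fun h => exists k, smooth D k /\ forall t, D t -> k t = h t)).
  - intros h [k [Sk Ek]]. exists (deriv D k). split.
    + exists (deriv D k). split; [now apply smooth_deriv|auto].
    + intros t Dt. apply (has_deriv_ext D k); auto.
      now apply smooth_has_deriv.
  - now exists f.
Qed.

Lemma smooth_const (k : R) : smooth D (fun _ => k).
Proof. apply smooth_of_expr, expr_const. Qed.

Lemma smooth_plus (f g : R -> R) :
  smooth D f -> smooth D g -> smooth D (fun s => f s + g s).
Proof. intros. apply smooth_of_expr. apply expr_plus; now apply expr_smooth. Qed.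

Lemma smooth_mult (f g : R -> R) :
  smooth D f -> smooth D g -> smooth D (fun s => f s * g s).
Proof. intros. apply smooth_of_expr. apply expr_mult; now apply expr_smooth. Qed.

Lemma smooth_inv (f : R -> R) : smooth D f -> (forall t, D t -> f t <> 0) ->
  smooth D (fun s => / f s).
Proof.
  intros. apply smooth_of_expr. apply expr_inv; [now apply expr_smooth|auto].
Qed.

Lemma smooth_sqrt (f : R -> R) : smooth D f -> (forall t, D t -> 0 < f t) ->
  smooth D (fun s => sqrt (f s)).
Proof.
  intros. apply smooth_of_expr. apply expr_sqrt; [now apply expr_smooth|auto].
Qed.

Lemma smooth_comb (p q : R) (f g : R -> R) :
  smooth D f -> smooth D g -> smooth D (fun s => p * f s + q * g s).
Proof.
  intros. apply smooth_plus; apply smooth_mult; auto using smooth_const.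
Qed.

(** * Legendre curves and their vertices *)

Lemma dot_unit (v : R2) : vnorm v = 1 -> dot v v = 1.
Proof.
  unfold vnorm. intros H.
  destruct (Rle_or_lt (dot v v) 0) as [h|h].
  (* [sqrt] takes the value 0 on nonpositive arguments, which contradicts norm 1. *)
  - rewrite (sqrt_neg_0 _ h) in H. lra.
  - rewrite <- (sqrt_sqrt (dot v v)) by lra. rewrite H. ring.
Qed.

(** The middle identity comes from differentiating [nu . nu = 1] along [D]. *)
Lemma legendre_dot (gamma nu : R -> R2) (t : R) :
  legendre D gamma nu -> D t ->
  dot (nu t) (nu t) = 1 /\ dot (vderiv D nu t) (nu t) = 0 /\
  dot (vderiv D gamma t) (nu t) = 0.
Proof.
  intros [_ [[S1 S2] [N O]]] Dt.
  split; [now apply dot_unit, N|]. split; [|now apply O].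
  pose proof (smooth_has_deriv _ t S1 Dt) as H1.
  pose proof (smooth_has_deriv _ t S2 Dt) as H2.
  pose proof (has_deriv_plus D _ _ t _ _ (has_deriv_mult D _ _ t _ _ H1 H1)
    (has_deriv_mult D _ _ t _ _ H2 H2)) as H.
  apply (has_deriv_ext D _ (fun _ => 1)) in H.
  - apply (has_deriv_unique _ t _ _ Dt (has_deriv_const D 1 t)) in H.
    unfold dot, vderiv; simpl. lra.
  - exact Dt.
  - intros s Ds. exact (dot_unit _ (N s Ds)).
Qed.

(** In [gamma' - alpha' nu - alpha nu'] the first and last terms cancel, since [beta = alpha ell]
    means [gamma' = alpha nu']. *)
Lemma evolute_deriv (gamma nu : R -> R2) (alpha : R -> R) (t : R) :
  legendre D gamma nu -> evolute_coef D gamma nu alpha -> D t ->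
  vderiv D (evolute gamma nu alpha) t = vscale (- deriv D alpha t) (nu t).
Proof.
  intros hL [Sa Ea] Dt.
  destruct (legendre_dot _ _ t hL Dt) as [N [O1 O2]].
  specialize (Ea t Dt). destruct hL as [[G1 G2] [[N1 N2] _]].
  pose proof (smooth_has_deriv _ t Sa Dt) as Ha.
  assert (E : forall f h, smooth D f -> smooth D h ->
    deriv D (fun s => f s - alpha s * h s) t =
    deriv D f t - (deriv D alpha t * h t + alpha t * deriv D h t)).
  { intros f h Sf Sh. apply has_deriv_deriv; [exact Dt|].
    apply has_deriv_minus; [now apply smooth_has_deriv|].
    apply has_deriv_mult; [exact Ha|now apply smooth_has_deriv]. }
  unfold vderiv at 1, evolute, vsub, vscale; simpl.
  rewrite (E _ _ G1 N1), (E _ _ G2 N2).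
  unfold curv_beta, curv_ell, dot, J, vderiv in *; simpl in *.
  set (g1 := deriv D (fun s => fst (gamma s)) t) in *.
  set (g2 := deriv D (fun s => snd (gamma s)) t) in *.
  set (n1 := deriv D (fun s => fst (nu s)) t) in *.
  set (n2 := deriv D (fun s => snd (nu s)) t) in *.
  set (a := fst (nu t)) in *. set (b := snd (nu t)) in *.
  set (al := alpha t) in *.
  (* [g - alpha n] is orthogonal both to [nu] and to [J nu]. *)
  assert (Z : (g1 - al * n1) * a + (g2 - al * n2) * b = 0).
  { replace (_ + _) with ((g1 * a + g2 * b) - al * (n1 * a + n2 * b)) by ring.
    rewrite O1, O2. ring. }
  assert (W : (g1 - al * n1) * - b + (g2 - al * n2) * a = 0) by lra.
  (* Each coordinate is recovered from the two components [Z] and [W] in the orthonormal frame [nu],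
     [J nu]. *)
  assert (g1 - al * n1 = 0).
  { transitivity ((g1 - al * n1) * (a * a + b * b)); [rewrite N; ring|].
    transitivity (((g1 - al * n1) * a + (g2 - al * n2) * b) * a
      - ((g1 - al * n1) * - b + (g2 - al * n2) * a) * b); [ring|].
    rewrite Z, W. ring. }
  assert (g2 - al * n2 = 0).
  { transitivity ((g2 - al * n2) * (a * a + b * b)); [rewrite N; ring|].
    transitivity (((g1 - al * n1) * a + (g2 - al * n2) * b) * b
      + ((g1 - al * n1) * - b + (g2 - al * n2) * a) * a); [ring|].
    rewrite Z, W. ring. }
  f_equal; lra.
Qed.

(** The evolute has derivative [- alpha' nu] with [nu] a unit vector, so it vanishes exactly when
    [alpha'] does. *)
Lemma vertex_iff (gamma nu : R -> R2) (t : R) :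
  legendre D gamma nu -> D t ->
  (vertex D gamma nu t <->
   exists alpha, unique_evolute_coef D gamma nu alpha /\ deriv D alpha t = 0).
Proof.
  intros hL Dt.
  pose proof (proj1 (legendre_dot _ _ t hL Dt)) as N. unfold dot in N.
  split.
  - intros [_ [alpha [U V]]]. exists alpha. split; [exact U|].
    rewrite (evolute_deriv _ _ _ _ hL (proj1 U) Dt) in V.
    unfold vscale in V. injection V as V1 V2.
    (* Minus the inner product of the vanishing vector with [nu]. *)
    transitivity (- (- deriv D alpha t * fst (nu t)) * fst (nu t)
      - (- deriv D alpha t * snd (nu t)) * snd (nu t)).
    + transitivity (deriv D alpha t
        * (fst (nu t) * fst (nu t) + snd (nu t) * snd (nu t))); [|ring].
      rewrite N. ring.
    + rewrite V1, V2. ring.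
  - intros [alpha [U V]]. split; [exact Dt|]. exists alpha. split; [exact U|].
    rewrite (evolute_deriv _ _ _ _ hL (proj1 U) Dt), V.
    unfold vscale. f_equal; ring.
Qed.

(** * Transfer of vertices under rescaling of the curvature *)

Section Transfer.

(** The curvatures [ell] and [beta] are multiplied by [p] and [p m], so the coefficient [alpha] is
    multiplied by [m]. *)
Context (gamma nu gammat nut : R -> R2) (p m : R -> R).
Hypothesis p0 : forall t, D t -> p t <> 0.
Hypothesis m0 : forall t, D t -> m t <> 0.
Hypothesis beta_eq : forall t, D t ->
  curv_beta D gammat nut t = p t * m t * curv_beta D gamma nu t.
Hypothesis ell_eq : forall t, D t ->
  curv_ell D nut t = p t * curv_ell D nu t.

Lemma evolute_coef_mult (alpha : R -> R) : smooth D m ->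
  evolute_coef D gamma nu alpha ->
  evolute_coef D gammat nut (fun s => alpha s * m s).
Proof.
  intros Sm [Sa Ea]. split; [now apply smooth_mult|].
  intros t Dt. rewrite beta_eq, ell_eq, Ea; auto. ring.
Qed.

Lemma evolute_coef_div (alpha : R -> R) : smooth D m ->
  evolute_coef D gammat nut alpha ->
  evolute_coef D gamma nu (fun s => alpha s * / m s).
Proof.
  intros Sm [Sa Ea]. split; [apply smooth_mult; auto using smooth_inv|].
  intros t Dt. specialize (Ea t Dt). rewrite beta_eq, ell_eq in Ea; auto.
  assert (hp := p0 t Dt). assert (hm := m0 t Dt).
  apply (Rmult_eq_reg_l (p t * m t)).
  - rewrite Ea. field. exact hm.
  - now apply Rmult_integral_contrapositive_currified.
Qed.

(** Where [alpha' = 0], the derivative of [alpha m] is [alpha m' = alpha ell s = beta s], which is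
    zero by hypothesis. *)
Lemma vertex_transfer (t s : R) :
  legendre D gamma nu -> legendre D gammat nut -> smooth D m -> D t ->
  has_deriv D m t (curv_ell D nu t * s) -> curv_beta D gamma nu t * s = 0 ->
  vertex D gamma nu t -> vertex D gammat nut t.
Proof.
  intros hL hLt Sm Dt Hm Hs V.
  apply (vertex_iff _ _ _ hL Dt) in V. destruct V as [alpha [[C U] V]].
  apply (vertex_iff _ _ _ hLt Dt). exists (fun s => alpha s * m s).
  split; [split|].
  - now apply evolute_coef_mult.
  (* A competing coefficient divided by [m] solves the original equation, hence equals [alpha]. *)
  - intros a' C' x Dx. rewrite <- (U _ (evolute_coef_div a' Sm C') x Dx).
    field. now apply m0.
  - apply has_deriv_deriv; [exact Dt|].
    pose proof (smooth_has_deriv _ t (proj1 C) Dt) as Ha. rewrite V in Ha.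
    refine (has_deriv_val D _ t _ _ _ (has_deriv_mult D _ _ t _ _ Ha Hm)).
    rewrite <- Rmult_assoc, <- (proj2 C t Dt), Hs. ring.
Qed.

End Transfer.

Lemma vertex_transfer_iff (gamma nu gammat nut : R -> R2) (p m : R -> R)
    (t s : R) :
  (forall t, D t -> p t <> 0) -> (forall t, D t -> m t <> 0) ->
  (forall t, D t ->
    curv_beta D gammat nut t = p t * m t * curv_beta D gamma nu t) ->
  (forall t, D t -> curv_ell D nut t = p t * curv_ell D nu t) ->
  legendre D gamma nu -> legendre D gammat nut -> smooth D m -> D t ->
  has_deriv D m t (curv_ell D nu t * s) -> curv_beta D gamma nu t * s = 0 ->
  (vertex D gamma nu t <-> vertex D gammat nut t).
Proof.
  intros p0 m0 Eb El hL hLt Sm Dt Hm Hs.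
  assert (hp := p0 t Dt). assert (hm := m0 t Dt). split.
  - now apply (vertex_transfer gamma nu gammat nut p m p0 m0 Eb El t s).
  (* The converse exchanges the curves and inverts [p] and [m]. The new [s] comes from
     [(1/m)' = - ell s / m^2], with [ell] replaced by the image curvature over [p]. *)
  - apply (vertex_transfer gammat nut gamma nu (fun x => / p x) (fun x => / m x))
      with (s := - (s * / p t * (/ m t * / m t))); auto using smooth_inv.
    + intros x Dx. now apply Rinv_neq_0_compat, p0.
    + intros x Dx. now apply Rinv_neq_0_compat, m0.
    + intros x Dx. rewrite Eb by exact Dx. field. auto.
    + intros x Dx. rewrite El by exact Dx. field. auto.
    + refine (has_deriv_val D _ t _ _ _ (has_deriv_inv D _ t _ hm Hm)).
      rewrite El by exact Dt. field. auto.
    + rewrite Eb by exact Dt.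
      transitivity (- (curv_beta D gamma nu t * s) * / m t); [field; auto|].
      rewrite Hs. ring.
Qed.

(** * Linear images of Legendre curves *)

Section Linear.

Context (gamma nu : R -> R2) (hL : legendre D gamma nu).
Context (a11 a12 a21 a22 : R) (hdet : a11 * a22 - a12 * a21 <> 0).

Let A (v : R2) : R2 := (a11 * fst v + a12 * snd v, a21 * fst v + a22 * snd v).
(** The cofactor matrix is [delta] times the inverse transpose of [A]. Thus
    [A v . B w = delta (v . w)], and [B] carries normals to normals. *)
Let B (v : R2) : R2 := (a22 * fst v - a21 * snd v, - a12 * fst v + a11 * snd v).
Let delta : R := a11 * a22 - a12 * a21.

Lemma vderiv_linear (c : R -> R2) (t : R) : vsmooth D c -> D t ->
  vderiv D (fun s => A (c s)) t = A (vderiv D c t).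
Proof.
  intros [S1 S2] Dt. unfold vderiv, A; simpl.
  f_equal; apply has_deriv_deriv; auto;
    apply has_deriv_plus; apply has_deriv_scal; now apply smooth_has_deriv.
Qed.

Lemma singular_linear (t : R) :
  singular_point D gamma t <-> singular_point D (fun s => A (gamma s)) t.
Proof.
  split; intros [Dt E]; split; auto;
    rewrite (vderiv_linear gamma t (proj1 hL) Dt) in *.
  - rewrite E. unfold A; simpl. f_equal; ring.
  - destruct (vderiv D gamma t) as [x y]. unfold A in E; simpl in E.
    injection E as E1 E2. f_equal; apply (Rmult_eq_reg_l delta); auto.
    (* Cramer's rule for both coordinates. *)
    + unfold delta. transitivity (a22 * (a11 * x + a12 * y)
        - a12 * (a21 * x + a22 * y)); [ring|]. rewrite E1, E2. ring.
    + unfold delta. transitivity (a11 * (a21 * x + a22 * y)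
        - a21 * (a11 * x + a12 * y)); [ring|]. rewrite E1, E2. ring.
Qed.

Lemma cofactor_norm_pos (v : R2) : dot v v = 1 -> 0 < dot (B v) (B v).
Proof.
  intros N. destruct v as [x y]. unfold dot, B in *; simpl in *.
  set (u := a22 * x - a21 * y). set (w := - a12 * x + a11 * y).
  destruct (Req_dec u 0) as [hu|hu]; [destruct (Req_dec w 0) as [hw|hw]|].
  - exfalso.
    (* The transpose of [A] inverts [B] up to the factor [delta], so [B v = 0] would force
       [v = 0]. *)
    assert (X : delta * x = a11 * u + a21 * w) by (unfold delta, u, w; ring).
    assert (Y : delta * y = a12 * u + a22 * w) by (unfold delta, u, w; ring).
    rewrite hu, hw, !Rmult_0_r, Rplus_0_r in X, Y.
    destruct (Rmult_integral _ _ X) as [|X0]; [contradiction|].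
    destruct (Rmult_integral _ _ Y) as [|Y0]; [contradiction|].
    rewrite X0, Y0 in N. lra.
  - pose proof (Rsqr_pos_lt w hw). pose proof (Rle_0_sqr u).
    unfold Rsqr in *. lra.
  - pose proof (Rsqr_pos_lt u hu). pose proof (Rle_0_sqr w).
    unfold Rsqr in *. lra.
Qed.

Lemma smooth_cofactor :
  smooth D (fun s => fst (B (nu s))) /\ smooth D (fun s => snd (B (nu s))).
Proof.
  destruct hL as [_ [[N1 N2] _]]. split.
  - apply (smooth_ext (fun s => a22 * fst (nu s) + - a21 * snd (nu s))).
    + intros. simpl. ring.
    + now apply smooth_comb.
  - now apply smooth_comb.
Qed.

Lemma smooth_cofactor_norm :
  smooth D (fun s => / vnorm (B (nu s))).
Proof.
  assert (P : forall t, D t -> 0 < dot (B (nu t)) (B (nu t))).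
  { intros t Dt. apply cofactor_norm_pos. now apply (legendre_dot gamma). }
  destruct smooth_cofactor as [S1 S2].
  apply smooth_inv.
  - apply (smooth_sqrt (fun s => dot (B (nu s)) (B (nu s)))); [|exact P].
    unfold dot. apply smooth_plus; now apply smooth_mult.
  - intros t Dt. pose proof (sqrt_lt_R0 _ (P t Dt)). unfold vnorm. lra.
Qed.

(** The scale is kept abstract, subject to [c^2 |B nu|^2 = 1] on [D], so as to cover both
    [1 / |B nu|] and the constant 1 used for the reflection. *)
Context (c : R -> R) (Sc : smooth D c).
Hypothesis c_norm : forall t, D t -> c t * c t * dot (B (nu t)) (B (nu t)) = 1.

Let nut (t : R) : R2 := vscale (c t) (B (nu t)).

Lemma scale_neq0 (t : R) : D t -> c t <> 0.
Proof.
  intros Dt E. specialize (c_norm t Dt). rewrite E in c_norm. lra.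
Qed.

Lemma vderiv_nut (t : R) : D t ->
  vderiv D nut t =
  (deriv D c t * fst (B (nu t)) + c t * fst (B (vderiv D nu t)),
   deriv D c t * snd (B (nu t)) + c t * snd (B (vderiv D nu t))).
Proof.
  intros Dt. destruct hL as [_ [[N1 N2] _]].
  pose proof (smooth_has_deriv _ t N1 Dt).
  pose proof (smooth_has_deriv _ t N2 Dt).
  unfold vderiv, nut, vscale; simpl.
  f_equal; apply has_deriv_deriv; auto.
  - apply (has_deriv_mult D c (fun s => fst (B (nu s))));
      [now apply smooth_has_deriv|].
    apply has_deriv_minus; now apply has_deriv_scal.
  - apply (has_deriv_mult D c (fun s => snd (B (nu s))));
      [now apply smooth_has_deriv|].
    apply has_deriv_plus; now apply has_deriv_scal.
Qed.

Lemma legendre_linear : legendre D (fun s => A (gamma s)) nut.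
Proof.
  destruct smooth_cofactor as [S1 S2].
  split; [|split; [|split]].
  - destruct hL as [[G1 G2] _]. split; now apply smooth_comb.
  - split; now apply smooth_mult.
  - intros t Dt. unfold vnorm.
    replace (dot (nut t) (nut t)) with 1; [exact sqrt_1|].
    rewrite <- (c_norm t Dt). unfold dot, nut, vscale; simpl. ring.
  - intros t Dt. rewrite (vderiv_linear gamma t (proj1 hL) Dt).
    (* This is [A v . B w = delta (v . w)]. *)
    transitivity (c t * delta * dot (vderiv D gamma t) (nu t)).
    + unfold dot, nut, vscale, A, B, delta; simpl. ring.
    + destruct (legendre_dot gamma nu t hL Dt) as [_ [_ O]]. rewrite O. ring.
Qed.

(** In the plane, a vector orthogonal to the unit vector [nu] is a multiple of [J nu]. *)
Lemma legendre_frame (t : R) : D t ->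
  vderiv D gamma t = vscale (curv_beta D gamma nu t) (J (nu t)) /\
  vderiv D nu t = vscale (curv_ell D nu t) (J (nu t)).
Proof.
  intros Dt. destruct (legendre_dot gamma nu t hL Dt) as [N [O1 O2]].
  assert (F : forall v, dot v (nu t) = 0 -> v = vscale (dot v (J (nu t))) (J (nu t))).
  { intros [x y]. destruct (nu t) as [a b]. unfold dot, vscale, J in *; simpl in *.
    intros E. f_equal.
    - transitivity (x * (a * a + b * b) - a * (x * a + y * b));
        [rewrite N, E; ring|ring].
    - transitivity (y * (a * a + b * b) - b * (x * a + y * b));
        [rewrite N, E; ring|ring]. }
  split; now apply F.
Qed.

(** By [A J = J B] the image velocity is [beta J B nu]; pairing it with [c J B nu] gives
    [beta c |B nu|^2 = beta / c]. *)
Lemma curv_beta_linear (t : R) : D t ->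
  curv_beta D (fun s => A (gamma s)) nut t = / c t * curv_beta D gamma nu t.
Proof.
  intros Dt. pose proof (scale_neq0 t Dt) as hc.
  unfold curv_beta at 1. rewrite (vderiv_linear gamma t (proj1 hL) Dt).
  rewrite (proj1 (legendre_frame t Dt)).
  transitivity (/ c t * curv_beta D gamma nu t
    * (c t * c t * dot (B (nu t)) (B (nu t)))).
  - unfold dot, nut, vscale, A, B, J; simpl. field. exact hc.
  - rewrite (c_norm t Dt). ring.
Qed.

(** The term with [c'] drops out because [B nu] is orthogonal to [J B nu]. The rest is [c^2 ell]
    times the determinant of [B nu] and [B J nu], which is [delta |nu|^2]. *)
Lemma curv_ell_linear (t : R) : D t ->
  curv_ell D nut t = delta * (c t * c t) * curv_ell D nu t.
Proof.
  intros Dt. unfold curv_ell at 1. rewrite (vderiv_nut t Dt).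
  rewrite (proj2 (legendre_frame t Dt)).
  transitivity (delta * (c t * c t) * curv_ell D nu t * dot (nu t) (nu t)).
  - unfold dot, nut, vscale, B, J, delta; simpl. ring.
  - rewrite (proj1 (legendre_dot gamma nu t hL Dt)). ring.
Qed.

(** Solving [nut' . nut = 0] for [c'] avoids differentiating the norm. *)
Lemma deriv_scale (t : R) : D t ->
  deriv D c t =
  - (c t * c t * c t * (curv_ell D nu t * dot (B (nu t)) (B (J (nu t))))).
Proof.
  intros Dt. pose proof (scale_neq0 t Dt) as hc.
  destruct (legendre_dot _ _ t legendre_linear Dt) as [_ [O _]].
  rewrite (vderiv_nut t Dt), (proj2 (legendre_frame t Dt)) in O.
  pose proof (c_norm t Dt) as N.
  set (l := curv_ell D nu t) in *. set (c' := deriv D c t) in *.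
  (* The orthogonality relation times [c], which turns the coefficient of [c'] into 1. *)
  assert (O' : c' * (c t * c t * dot (B (nu t)) (B (nu t)))
    + c t * c t * c t * (l * dot (B (nu t)) (B (J (nu t)))) = 0).
  { transitivity (c t * 0); [|ring]. rewrite <- O.
    unfold dot, nut, vscale, B, J; simpl. ring. }
  rewrite N in O'. lra.
Qed.

(** The hypothesis holds at a singular point, where [beta = 0], and everywhere if [B] preserves
    orthogonality. *)
Lemma vertex_linear (t : R) : D t ->
  curv_beta D gamma nu t * dot (B (nu t)) (B (J (nu t))) = 0 ->
  (vertex D gamma nu t <-> vertex D (fun s => A (gamma s)) nut t).
Proof.
  intros Dt Hz.
  assert (hd : delta <> 0) by exact hdet.
  assert (q0 : forall s, D s -> delta * (c s * c s * c s) <> 0).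
  { intros s Ds. pose proof (scale_neq0 s Ds).
    repeat apply Rmult_integral_contrapositive_currified; auto. }
  assert (Sq : smooth D (fun s => delta * (c s * c s * c s))).
  { repeat apply smooth_mult; auto using smooth_const. }
  pose proof (scale_neq0 t Dt) as hc.
  (* Here [p = delta c^2] and [m = 1 / (delta c^3)], so [p m = 1 / c]. Inserting [deriv_scale] into
     [m' = - 3 c' / (delta c^4)] yields the factor [s]. *)
  apply (vertex_transfer_iff gamma nu (fun s => A (gamma s)) nut
    (fun s => delta * (c s * c s)) (fun s => / (delta * (c s * c s * c s))))
    with (s := 3 * dot (B (nu t)) (B (J (nu t))) * / (delta * c t));
    auto using legendre_linear, curv_ell_linear, smooth_inv.
  - intros s Ds. pose proof (scale_neq0 s Ds).
    repeat apply Rmult_integral_contrapositive_currified; auto.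
  - intros s Ds. now apply Rinv_neq_0_compat, q0.
  - intros s Ds. rewrite (curv_beta_linear s Ds). field.
    split; [now apply scale_neq0|exact hd].
  - pose proof (smooth_has_deriv c t Sc Dt) as Hc.
    refine (has_deriv_val D _ t _ _ _ (has_deriv_inv D _ t _ (q0 t Dt)
      (has_deriv_scal D delta _ t _ (has_deriv_mult D _ _ t _ _
        (has_deriv_mult D _ _ t _ _ Hc Hc) Hc)))).
    rewrite (deriv_scale t Dt). field. auto.
  - transitivity (curv_beta D gamma nu t * dot (B (nu t)) (B (J (nu t)))
      * (3 * / (delta * c t))); [ring|]. rewrite Hz. ring.
Qed.

End Linear.

End Interval.

(** * General linear maps and the reflection in the diagonal *)

Theorem proposition3p6 (D : R -> Prop) (gamma nu : R -> R2)
    (hD : closed_interval D) (hL : legendre D gamma nu) :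
  (forall a11 a12 a21 a22 : R, a11 * a22 - a12 * a21 <> 0 ->
    let Phi := fun v : R2 =>
      (a11 * fst v + a12 * snd v, a21 * fst v + a22 * snd v) in
    let nubar := fun t : R =>
      (a22 * fst (nu t) - a21 * snd (nu t),
       - a12 * fst (nu t) + a11 * snd (nu t)) in
    let gammat := fun t : R => Phi (gamma t) in
    let nut := fun t : R => vscale (/ vnorm (nubar t)) (nubar t) in
    legendre D gammat nut /\
    forall t0 : R, D t0 ->
      (singular_point D gamma t0 /\ vertex D gamma nu t0 <->
       singular_point D gammat t0 /\ vertex D gammat nut t0))
  /\
  (let Phi := fun v : R2 => (snd v, fst v) in
   let gammat := fun t : R => Phi (gamma t) in
   let nut := fun t : R => (- snd (nu t), - fst (nu t)) in
   legendre D gammat nut /\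
   forall t0 : R, D t0 ->
     (vertex D gamma nu t0 <-> vertex D gammat nut t0)).
Proof.
  split.
  - intros a11 a12 a21 a22 hdet Phi nubar gammat nut.
    set (c := fun t => / vnorm (nubar t)).
    assert (Sc : smooth D c)
      by exact (smooth_cofactor_norm hD gamma nu hL a11 a12 a21 a22 hdet).
    assert (c_norm : forall t, D t -> c t * c t * dot (nubar t) (nubar t) = 1).
    { intros t Dt.
      pose proof (cofactor_norm_pos a11 a12 a21 a22 hdet (nu t)
        (proj1 (legendre_dot hD gamma nu t hL Dt))) as P.
      pose proof (sqrt_lt_R0 _ P) as Q.
      pose proof (sqrt_sqrt _ (Rlt_le _ _ P)) as E.
      change (sqrt (dot (nubar t) (nubar t)) * sqrt (dot (nubar t) (nubar t))
        = dot (nubar t) (nubar t)) in E.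
      change (0 < sqrt (dot (nubar t) (nubar t))) in Q.
      unfold c, vnorm. rewrite <- E at 3. field. lra. }
    split.
    { exact (legendre_linear hD gamma nu hL a11 a12 a21 a22 c Sc c_norm). }
    intros t Dt.
    pose proof (singular_linear hD gamma nu hL a11 a12 a21 a22 hdet t) as HS.
    assert (HV : singular_point D gamma t ->
      (vertex D gamma nu t <-> vertex D gammat nut t)).
    { intros [_ E].
      apply (vertex_linear hD gamma nu hL a11 a12 a21 a22 hdet c Sc c_norm t Dt).
      unfold curv_beta. rewrite E. unfold dot at 1; simpl. ring. }
    split; intros [S V].
    + split; [now apply HS|now apply HV].
    + apply HS in S. split; [exact S|now apply HV].
  - intros Phi gammat nut.
    (* The swap is the linear map with entries 0, 1, 1, 0; its cofactor matrix sends [(a, b)] to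
       [(-b, -a)], already of norm 1, so [c = 1]. *)
    assert (hdet : 0 * 0 - 1 * 1 <> 0) by lra.
    assert (c_norm : forall t, D t -> 1 * 1 *
      dot (0 * fst (nu t) - 1 * snd (nu t), - (1) * fst (nu t) + 0 * snd (nu t))
        (0 * fst (nu t) - 1 * snd (nu t), - (1) * fst (nu t) + 0 * snd (nu t))
      = 1).
    { intros t Dt.
      transitivity (dot (nu t) (nu t)); [unfold dot; simpl; ring|].
      now apply (legendre_dot hD gamma). }
    assert (Eg : gammat = fun t => (0 * fst (gamma t) + 1 * snd (gamma t),
      1 * fst (gamma t) + 0 * snd (gamma t))).
    { apply functional_extensionality. intros t. unfold gammat, Phi.
      f_equal; ring. }
    assert (En : nut = fun t => vscale 1 (0 * fst (nu t) - 1 * snd (nu t),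
      - (1) * fst (nu t) + 0 * snd (nu t))).
    { apply functional_extensionality. intros t. unfold nut, vscale; simpl.
      f_equal; ring. }
    rewrite Eg, En. split.
    + exact (legendre_linear hD gamma nu hL 0 1 1 0 (fun _ => 1)
        (smooth_const hD 1) c_norm).
    + intros t Dt.
      apply (vertex_linear hD gamma nu hL 0 1 1 0 hdet (fun _ => 1)
        (smooth_const hD 1) c_norm t Dt).
      (* The cofactor matrix of the reflection is an isometry, so [B nu] and [B J nu] are orthogonal
         at every point. *)
      unfold dot, J; simpl. ring.
Qed.
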